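(* Let $k \geq 3$ be an integer and let $H$ be a $k$-connected graph with girth at least $k$. Then every inflation of $H$ is cyclically $k$-edge-connected.
   Context: All graphs are finite and simple. A cubic graph is a $3$-regular graph. Let $H$ be a graph and let $G$ be a cubic graph. Then $G$ is called an inflation of $H$ if $G$ contains a $2$-factor $F$ (a spanning $2$-regular subgraph) consisting of chordless cycles such that the graph obtained from $G$ by contracting each cycle of $F$ to a vertex is isomorphic to $H$. For an integer $k$, a connected cubic graph $G$ which contains two (vertex-)disjoint cycles is said to be cyclically $k$-edge-connected if deleting any set of at most $k-1$ edges from $G$ does not separate $G$ into two components both of which have a cycle. $k$-connected means $k$-vertex-connected; the girth is the length of a shortest cycle. *)

(* Defs.v *)
From mathcomp Require Import all_boot.

Set Implicit Arguments.
Unset Strict Implicit.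
Unset Printing Implicit Defensive.

Record sgraph := SGraph {
  vertex :> finType;
  adj : rel vertex;
  adj_sym : symmetric adj;
  adj_irrefl : irreflexive adj }.

Definition edges (G : sgraph) : {set {set G}} :=
  [set [set p.1; p.2] | p in [pred p : G * G | adj p.1 p.2]].

Definition regular (d : nat) (G : sgraph) : Prop :=
  forall x : G, #|[set y | adj x y]| = d.

Definition cubic (G : sgraph) : Prop := regular 3 G.

(* A cycle is given by the sequence of its vertices, in cyclic order. *)
Definition is_cycle (G : sgraph) (c : seq G) : bool :=
  [&& 2 < size c, uniq c & cycle (@adj G) c].

Definition chordless (G : sgraph) (c : seq G) : Prop :=
  forall x y, x \in c -> y \in c -> adj x y -> y = next c x \/ y = prev c x.

(* [None] stands for the infinite girth of a forest; a cycle of [G] has at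
   most [#|G|] vertices, so the list contains all cycle lengths, in increasing
   order. *)
Definition girth (G : sgraph) : option nat :=
  ohead [seq n <- iota 0 #|G|.+1 | [exists c : n.-tuple G, is_cycle c]].

Definition girth_geq (G : sgraph) (k : nat) : bool :=
  if girth G is Some g then k <= g else true.

Definition connected (G : sgraph) : Prop :=
  0 < #|G| /\ forall x y : G, connect (@adj G) x y.

Definition component (G : sgraph) (x : G) : {set G} :=
  [set y | connect (@adj G) x y].

Definition components (G : sgraph) : {set {set G}} :=
  [set component x | x : G].

Section Subgraphs.
Variable G : sgraph.

Definition induced_adj (S : {set G}) : rel {x : G | x \in S} :=
  fun x y => adj (val x) (val y).

Lemma induced_sym (S : {set G}) : symmetric (@induced_adj S).
Proof. by move=> x y; exact: adj_sym. Qed.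

Lemma induced_irrefl (S : {set G}) : irreflexive (@induced_adj S).
Proof. by move=> x; exact: adj_irrefl. Qed.

Definition induced (S : {set G}) : sgraph :=
  SGraph (@induced_sym S) (@induced_irrefl S).

Definition spanning_adj (F : {set {set G}}) : rel G :=
  fun x y => adj x y && ([set x; y] \in F).

Lemma spanning_sym (F : {set {set G}}) : symmetric (spanning_adj F).
Proof. by move=> x y; rewrite /spanning_adj adj_sym setUC. Qed.

Lemma spanning_irrefl (F : {set {set G}}) : irreflexive (spanning_adj F).
Proof. by move=> x; rewrite /spanning_adj adj_irrefl. Qed.

(* The spanning subgraph with edge set [F :&: edges G]. *)
Definition spanning (F : {set {set G}}) : sgraph :=
  SGraph (spanning_sym F) (spanning_irrefl F).

Definition del_vertices (X : {set G}) : sgraph := induced (~: X).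

Definition del_edges (D : {set {set G}}) : sgraph := spanning (~: D).

End Subgraphs.

Definition k_connected (k : nat) (G : sgraph) : Prop :=
  k < #|G| /\ forall X : {set G}, #|X| < k -> connected (del_vertices X).

Definition two_factor (G : sgraph) (F : {set {set G}}) : Prop :=
  F \subset edges G /\ regular 2 (spanning F).

(* Multigraphs: distinct edges may have the same ends, and a loop is an edge
   whose set of ends is a singleton. *)
Record mgraph := MGraph {
  mvertex : finType;
  medge : finType;
  ends : medge -> {set mvertex};
  ends_card : forall e, 0 < #|ends e| <= 2 }.

Definition miso (M N : mgraph) : Prop :=
  exists (f : mvertex M -> mvertex N) (g : medge M -> medge N),
    [/\ bijective f, bijective g & forall e, ends (g e) = f @: ends e].

Lemma card_edge (G : sgraph) (e : {set G}) : e \in edges G -> #|e| = 2.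
Proof.
case/imsetP=> -[x y] /=; rewrite inE /= => xy ->.
by rewrite cards2; case: eqP xy => // ->; rewrite adj_irrefl.
Qed.

Section MultigraphOf.
Variable G : sgraph.

Lemma multigraph_of_card (e : {e : {set G} | e \in edges G}) :
  0 < #|val e| <= 2.
Proof. by rewrite (card_edge (valP e)). Qed.

Definition multigraph_of : mgraph := MGraph multigraph_of_card.

End MultigraphOf.

Section Contraction.
Variables (G : sgraph) (F : {set {set G}}).

Definition cvertex : finType :=
  {A : {set G} | A \in components (spanning F)}.

Definition cedge : finType := {e : {set G} | e \in edges G :\: F}.

Lemma component_in (x : G) :
  @component (spanning F) x \in components (spanning F).
Proof. exact: imset_f. Qed.

Definition cproj (x : G) : cvertex :=
  exist (fun A : {set G} => A \in components (spanning F)) _ (component_in x).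

Definition cends (e : cedge) : {set cvertex} := cproj @: val e.

Lemma cends_card e : 0 < #|cends e| <= 2.
Proof.
have /setDP[/card_edge e2 _] := valP e.
apply/andP; split; last by rewrite -[X in _ <= X]e2; exact: leq_imset_card.
by rewrite card_gt0 imset_eq0 -card_gt0 e2.
Qed.

(* Contracts every component of the subgraph [F] to a vertex, keeping all the
   remaining edges of [G], possibly as loops or parallel edges. *)
Definition contract : mgraph := MGraph cends_card.

End Contraction.

(* As [H] is simple, the isomorphism forbids loops and parallel edges in the
   contracted graph. *)
Definition inflation (G H : sgraph) : Prop :=
  cubic G /\
  exists F : {set {set G}},
    [/\ two_factor F,
        forall c : seq G, @is_cycle (spanning F) c -> chordless c
      & miso (contract F) (multigraph_of H)].

Definition two_disjoint_cycles (G : sgraph) : Prop :=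
  exists c1 c2 : seq G, [/\ is_cycle c1, is_cycle c2 & [disjoint c1 & c2]].

Definition has_cycle_in (G : sgraph) (A : {set G}) : Prop :=
  exists2 c : seq G, is_cycle c & {subset c <= A}.

Definition cyclically_edge_connected (k : nat) (G : sgraph) : Prop :=
  [/\ cubic G, connected G, two_disjoint_cycles G
    & forall D : {set {set G}}, D \subset edges G -> #|D| < k ->
      ~ exists A B : {set del_edges D},
          [/\ A \in components (del_edges D), B \in components (del_edges D),
              A != B, @has_cycle_in (del_edges D) A & @has_cycle_in (del_edges D) B]].

(* Main.v *)
(* Let p : G -> H be the contraction, S a component of G - D, and X, U, W the
   sets of vertices of H whose F-cycle crosses S, lies inside S, lies outside S.
   The edge cut of S has at least |X| + |E_H(U, W)| edges: one F-edge in each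
   crossing cycle, and one edge above each edge of E_H(U, W). If U and W are
   both nonempty, k-connectedness of H makes this sum at least k. If U is empty,
   let Z be the vertex set of a cycle inside S, so that p(Z) is contained in X.
   No F-cycle lies in Z, so by parity Z is left through at least two edges
   outside F at each F-cycle it meets, and these have distinct images in H: the
   subgraph induced by p(Z) has minimum degree 2, and hence contains a cycle of
   length at most |X| < k, against the girth of H. The case of empty W is
   symmetric. *)
Require Import Defs.
From mathcomp Require Import all_boot.

Set Implicit Arguments.
Unset Strict Implicit.
Unset Printing Implicit Defensive.

(** * Walks, degrees and cycles in finite graphs *)

Lemma connect_crossing (T : finType) (e : rel T) (S : {set T}) (x y : T) :
  connect e x y -> x \in S -> y \notin S ->
  exists a b, [/\ e a b, a \in S, b \notin S & connect e x a].
Proof.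
case/connectP=> q; elim: q x => [|z q IHq] x /= => [_ -> ->//|].
case/andP=> exz qP yE xS yS; have [zS|zS] := boolP (z \in S).
  have [a [b [eab aS bS za]]] := IHq z qP yE zS yS.
  by exists a, b; split=> //; apply: connect_trans za; exact: connect1.
by exists x, z; split.
Qed.

(** Ordering vertices by [enum_rank] counts each edge once, from its smaller end; the degree sum is
    twice that count. *)
Lemma handshake (T : finType) (P : {set T}) (r : rel T) :
  symmetric r -> irreflexive r ->
  ~~ odd (\sum_(x in P) #|[set y in P | r x y]|).
Proof.
move=> rsym rirr; pose lt (x y : T) := enum_rank x < enum_rank y.
pose s := \sum_(x in P) \sum_(y in P) (r x y && lt x y).
suff ->: \sum_(x in P) #|[set y in P | r x y]| = s + s.
  by rewrite addnn odd_double.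
rewrite {2}/s exchange_big -big_split /=; apply: eq_bigr => x xP.
have -> : #|[set y in P | r x y]| = \sum_(y in P) r x y.
  rewrite -sum1_card [RHS](eq_bigr (fun y => if r x y then 1 else 0)).
    by rewrite -big_mkcondr; apply: eq_bigl => y; rewrite inE.
  by move=> y _; case: (r x y).
rewrite -big_split /=; apply: eq_bigr => y yP.
rewrite (rsym y x); case rxy: (r x y) => //=.
rewrite /lt; case: ltngtP => // /val_inj/enum_rank_inj xy.
by rewrite xy rirr in rxy.
Qed.

Lemma cycle_degree (G : sgraph) (c : seq G) (x : G) :
  is_cycle c -> x \in c -> 1 < #|[set y | (y \in c) && adj x y]|.
Proof.
case/and3P=> c2 cu cc xc; apply/card_gt1P; exists (next c x), (prev c x).
rewrite !inE mem_next mem_prev xc (next_cycle cc xc) adj_sym (prev_cycle cc xc).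
split=> //; case/rot_to: xc => i q cE.
(* With [x] rotated to the front, [next] is the second vertex and [prev] the last; they differ
   because the cycle has at least three vertices. *)
rewrite -(next_rot i cu) -(prev_rot i cu).
move: c2 cu; rewrite -(size_rot i c) -(rot_uniq i c) cE.
case: q {cE} => [|y q] // sz /andP[xq /andP[yq _]].
rewrite next_nth prev_nth mem_head (memNindex xq) (nth_last x [:: x, y & q]) /= eqxx /=.
case: q sz {xq} yq => [|z q] //= _; apply: contraNneq => ->; exact: mem_last.
Qed.

Lemma min_degree_cycle (G : sgraph) (T : {set G}) :
  T != set0 -> (forall t, t \in T -> 1 < #|[set y in T | adj t y]|) ->
  exists2 c, is_cycle c & {subset c <= T}.
Proof.
case/set0Pn=> t0 t0T degT.
(* All neighbors in T of the first vertex of a longest path in T lie on it. *)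
pose P n := [exists q : n.-tuple G,
  [&& 0 < size q, uniq q, all (mem T) q & sorted (@adj G) q]].
have exP : exists n, P n.
  by exists 1; apply/existsP; exists [tuple t0]; rewrite /= t0T.
have ubP n : P n -> n <= #|G|.
  by case/existsP=> q /and4P[_ qu _ _]; rewrite -(size_tuple q) -(card_uniqP qu) max_card.
case: (ex_maxnP exP ubP) => n /existsP[[q /= /eqP qn]] /and4P[].
case: q qn => [|x q] //= qn _ qu /andP[xT /allP qT] qpath nmax.
have nbq y : y \in T -> adj x y -> y \in q.
  move=> yT xy; apply: contraT => yq.
  suff: P n.+1 by move/nmax; rewrite ltnn.
  have sz : size [:: y, x & q] == n.+1 by rewrite /= -qn.
  apply/existsP; exists (Tuple sz) => /=.
  rewrite yT xT adj_sym xy qpath inE negb_or yq !andbT /=; case/andP: (qu) => -> ->.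
  rewrite !andbT; apply/andP; split; last exact/allP.
  by apply: contraTneq xy => ->; rewrite adj_irrefl.
have /card_gt1P[a [b []]] := degT x xT.
rewrite !inE => /andP[aT xa] /andP[bT xb] ab.
(* Of two neighbors of [x], one is not its successor on the path; the stretch of path from [x] to it
   closes up to a cycle of length at least 3. *)
have [y yT [xy yh]] : exists2 y, y \in T & adj x y /\ y != head x q.
  by have [ah|] := eqVneq a (head x q); [exists b|exists a] => //; rewrite -ah eq_sym.
have yq := nbq y yT xy.
case/splitPr: yq qu qT qpath yh {qn nbq} => q1 q2 qu qT qpath yh.
case: q1 qu qT qpath yh => [|z q1] qu qT qpath yh; first by rewrite /= eqxx in yh.
rewrite -cat_rcons in qu qT qpath; exists (x :: rcons (z :: q1) y).
  apply/and3P; split; first by rewrite /= size_rcons.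
    by move: qu; rewrite mem_cat negb_or cat_uniq => /andP[/andP[xq _] /andP[qq _]]; apply/andP.
  rewrite (cycle_path x) /= last_rcons adj_sym xy.
  by move: qpath; rewrite cat_path => /andP[].
move=> v; rewrite inE => /predU1P[->//|vq].
by apply: qT; rewrite mem_cat vq.
Qed.

Lemma girth_leq (G : sgraph) (k : nat) (c : seq G) :
  girth_geq G k -> is_cycle c -> k <= size c.
Proof.
move=> Gk cc; move: Gk; rewrite /girth_geq /girth.
set s := [seq _ <- _ | _].
have cs : size c \in s.
  rewrite mem_filter mem_iota /= add0n ltnS; apply/andP; split.
    by apply/existsP; exists (in_tuple c).
  by case/and3P: cc => _ cu _; rewrite -(card_uniqP cu) max_card.
have: sorted leq s by apply: sorted_filter; [exact: leq_trans|exact: iota_sorted].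
case: s cs => [|g s] //=; rewrite inE => /orP[/eqP->//|cs] gs kg.
by apply: leq_trans kg _; move/order_path_min: gs => /(_ leq_trans)/allP->.
Qed.

(** * Cuts made of vertices and edges in a [k]-connected graph *)

Definition edges_between (G : sgraph) (U W : {set G}) : {set {set G}} :=
  [set [set q.1; q.2] |
    q in [pred q : G * G | [&& adj q.1 q.2, q.1 \in U & q.2 \in W]]].

Lemma edges_betweenP (G : sgraph) (U W : {set G}) (e : {set G}) :
  reflect (exists x y, [/\ adj x y, x \in U, y \in W & e = [set x; y]])
          (e \in edges_between U W).
Proof.
apply: (iffP imsetP) => [[[x y]]|[x [y [xy xU yW ->]]]].
  by rewrite inE /= => /and3P[xy xU yW] ->; exists x, y.
by exists (x, y) => //; rewrite inE /= xy xU.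
Qed.

(** A mixed cut becomes a set of vertices of at most the same size once each of its edges is
    replaced by one of its ends. *)
Lemma k_connected_mixed_cut (H : sgraph) (k : nat) (U W : {set H}) :
  k_connected k H -> U != set0 -> W != set0 -> [disjoint U & W] ->
  k <= #|~: (U :|: W)| + #|edges_between U W|.
Proof.
case=> kH Hk /set0Pn[u0 u0U] /set0Pn[w0 w0W] dUW.
rewrite leqNgt; apply/negP => small.
have neq x y : x \in U -> y \in W -> x != y.
  by move=> xU yW; apply: contraTneq yW => <-; rewrite (disjointFr dUW).
(* Each edge e between U and W is destroyed by deleting an end phi u w e of it
   other than u and w, which exists unless e = uw. *)
pose phi (u w : H) (e : {set H}) := odflt w [pick x in e :\ u :\ w].
pose Y u w := ~: (U :|: W) :|: phi u w @: edges_between U W.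
have Yk u w : #|Y u w| < k.
  apply: leq_ltn_trans small; apply: leq_trans (leq_card_setU _ _) _.
  by rewrite leq_add2l leq_imset_card.
have [/existsP[u /existsP[w /and3P[uU wW uw]]]|all_adj] :=
  boolP [exists u, exists w, [&& u \in U, w \in W & ~~ adj u w]].
  have phiP x y : x \in U -> y \in W -> adj x y ->
      [/\ phi u w [set x; y] \in [set x; y], phi u w [set x; y] != u &
          phi u w [set x; y] != w].
    move=> xU yW xy; rewrite /phi; case: pickP => [z|] /=.
      by rewrite in_setD1 in_setD1 => /and3P[zw zu ze]; split.
    move=> none; have := none x; have := none y; rewrite !inE !eqxx orbT !andbT /=.
    rewrite (neq x w) //= (eq_sym y u) (neq u y) //= andbT.
    by move=> /negbFE/eqP yw /negbFE/eqP xu; rewrite -xu -yw xy in uw.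
  have notY v : v = u \/ v = w -> v \in ~: Y u w.
    move=> vuw; rewrite !inE negb_or; apply/andP; split.
      by case: vuw => ->; rewrite ?uU ?wW ?orbT.
    apply/imsetP => -[e /edges_betweenP[x [y [xy xU yW ->]]]].
    by have [_ /eqP nu /eqP nw] := phiP x y xU yW xy; case: vuw => ->; auto.
  have [_ /(_ (Sub u (notY u (or_introl erefl))) (Sub w (notY w (or_intror erefl))))] :=
    Hk _ (Yk u w).
  set u' := Sub u _; set w' := Sub w _ => uw'.
  (* What remains of [H] lies in [U] and [W], so the path from [u] to [w] uses an edge between them,
     yet [phi] selects a deleted end of that edge. *)
  have := @connect_crossing _ _ [set v | val v \in U] _ _ uw'.
  rewrite !inE /= uU (disjointFl dUW wW) => /(_ isT isT)[a [b [ab]]].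
  rewrite !inE => aU bU _.
  have bW : val b \in W.
    by have := valP b; rewrite !inE (negPf bU) /= negb_or negbK => /andP[].
  have [+ _ _] := phiP _ _ aU bW ab.
  have: phi u w [set val a; val b] \in Y u w.
    by rewrite inE; apply/orP; right; apply: imset_f;
      apply/edges_betweenP; exists (val a), (val b).
  move=> inY; rewrite !inE => /orP[] /eqP E; rewrite E in inY.
    by have := valP a; rewrite inE inY.
  by have := valP b; rewrite inE inY.
(* Otherwise U and W are completely joined, and the same set of vertices is all
   of H but u0, so that |H| - 1 < k. *)
have full : ~: [set u0] \subset Y u0 w0.
  have adjUW x y : x \in U -> y \in W -> adj x y.
    move=> xU yW; apply: contraR all_adj => nxy.
    by apply/existsP; exists x; apply/existsP; exists y; rewrite xU yW.
  have inY x y : x \in U -> y \in W -> phi u0 w0 [set x; y] \in Y u0 w0.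
    move=> xU yW; rewrite inE; apply/orP; right; apply: imset_f; apply/edges_betweenP.
    by exists x, y; split=> //; exact: adjUW.
  apply/subsetP => v; rewrite !inE => vu.
  have [vU|vU] := boolP (v \in U).
    suff E: phi u0 w0 [set v; w0] = v by have := inY v w0 vU w0W; rewrite E !inE vU.
    rewrite /phi; case: pickP => [z|/(_ v)]; rewrite !inE ?vu ?(neq v w0) ?eqxx //=.
    by case/and3P=> /negPf-> _; rewrite orbF => /eqP.
  rewrite /= -implybE; apply/implyP => vW.
  suff E: phi u0 w0 [set u0; v] = v by have := inY u0 v u0U vW; rewrite E !inE vW orbT.
  rewrite /phi; case: pickP => [z|/(_ v)]; rewrite !inE ?vu ?eqxx ?orbT ?andbT /=.
    by case/and3P=> _ /negPf-> /eqP.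
  (* Here [v] is [w0]: the edge from [u0] to [w0] has no third end, and the default value of [phi]
     supplies [w0]. *)
  by move/negbFE/eqP.
have := leq_ltn_trans (subset_leq_card full) (Yk u0 w0).
rewrite cardsC1 => lt; suff: k <= #|H|.-1 by rewrite leqNgt lt.
by rewrite -ltnS prednK // (leq_ltn_trans _ kH).
Qed.

(** * The contraction as a map on vertices *)

Lemma set2_edges (G : sgraph) (x y : G) : ([set x; y] \in edges G) = adj x y.
Proof.
apply/imsetP/idP => [[[a b]]|xy]; last by exists (x, y).
rewrite inE /= => ab E.
have xy : x != y.
  apply: contraTneq ab => xy; move/(congr1 (fun A : {set G} => #|A|)): E.
  by rewrite !cards2 xy eqxx; case: eqP => // ->; rewrite adj_irrefl.
move: (set21 x y) (set22 x y) xy; rewrite E !inE.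
by do 2![case/orP=> /eqP->]; rewrite ?eqxx // adj_sym.
Qed.

(** This is the isomorphism with the contraction, stated without multigraphs: by the last three
    fields, taking images under [p] is a bijection from the edges outside [F] to the edges of
    [H]. *)
Record quotient_map (G H : sgraph) (F : {set {set G}}) (p : G -> H) : Prop :=
  QuotientMap {
    quo_fibre : forall x y, p x = p y <-> connect (spanning_adj F) x y;
    quo_surj : forall v, exists x, p x = v;
    quo_edge : forall e, e \in edges G :\: F -> p @: e \in edges H;
    quo_inj : {in edges G :\: F &, injective (fun e : {set G} => p @: e)};
    quo_lift : forall e, e \in edges H ->
      exists2 e', e' \in edges G :\: F & e = p @: e' }.

Lemma inflation_quotient (G H : sgraph) :
  inflation G H ->
  exists (F : {set {set G}}) (p : G -> H),
    [/\ cubic G, regular 2 (spanning F) & quotient_map F p].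
Proof.
case=> cG [F [[_ F2] _ [f [g [[f' fK f'K] [g' gK g'K] gf]]]]].
pose p (x : G) : H := f (cproj F x); have pE (e : cedge F) : p @: val e = val (g e).
  rewrite -[RHS]/(@ends (multigraph_of H) (g e)) gf.
  rewrite -[@ends (contract F) e]/(cproj F @: val e).
  by rewrite -imset_comp.
exists F, p; split=> //; split.
- move=> x y; have csym : connect_sym (spanning_adj F).
    by apply: sym_connect_sym; exact: spanning_sym.
  split=> [/(can_inj fK)/(congr1 val)/= /setP/(_ y)|xy].
    by rewrite !inE connect0 => ->.
  congr f; apply: val_inj; apply/setP => z; rewrite !inE.
  exact: (same_connect csym xy).
- move=> v; case: (f' v) (f'K v) => A AF /= <-.
  have /imsetP[x _ AE] := AF; exists x; congr f; exact: val_inj.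
- by move=> e eF; rewrite -[e]/(val (Sub e eF : cedge F)) pE (valP (g _)).
- move=> e e' eF e'F; rewrite -[e]/(val (Sub e eF : cedge F)).
  rewrite -[e']/(val (Sub e' e'F : cedge F)).
  by rewrite !pE => /val_inj/(can_inj gK) ->.
move=> e eH; have := g'K (Sub e eH); set e' := g' _ => ge'.
by exists (val e'); [exact: valP|rewrite pE ge'].
Qed.

Section Quotient.

Variables (G H : sgraph) (F : {set {set G}}) (p : G -> H).
Hypotheses (cubG : cubic G) (regF : regular 2 (spanning F)) (quo : quotient_map F p).

Lemma quo_adj (x y : G) : adj x y -> [set x; y] \notin F -> adj (p x) (p y).
Proof.
move=> xy xyF; rewrite -set2_edges -imset_set1 -imset_set1 -imsetU.
by apply: (quo_edge quo); rewrite inE xyF set2_edges.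
Qed.

(** A walk in [H] lifts edge by edge, and [F] joins the end of one lifted edge to the start of the
    next within their common fibre. *)
Lemma quotient_connected : connected H -> connected G.
Proof.
case=> /card_gt0P[v _] conH.
have [x0 _] := quo_surj quo v; split; first by apply/card_gt0P; exists x0.
have sub x y : p x = p y -> connect (@adj G) x y.
  move/(quo_fibre quo); apply: connect_sub => a b /andP[ab _]; exact: connect1.
move=> x y; have /connectP[q] := conH (p x) (p y).
elim: q x => [|v1 q IHq] x /= => [_ /esym /sub //|/andP[xv qP] yE].
have [|e' /setDP[/imsetP[[a b]]]] := quo_lift quo (e := [set p x; v1]);
  first by rewrite set2_edges.
rewrite inE /= => ab -> _.
rewrite imsetU !imset_set1 => E.
have [a' [b' [ab' pa' pb']]] : exists a' b', [/\ adj a' b', p a' = p x & p b' = v1].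
  have nxv : p x != v1 by apply: contraTneq xv => ->; rewrite adj_irrefl.
  move: (set21 (p x) v1) (set22 (p x) v1) nxv; rewrite E !inE.
  case/orP=> /eqP-> /orP[] /eqP-> ; rewrite ?eqxx // => _; first by exists a, b.
  by exists b, a; rewrite adj_sym.
apply: connect_trans (sub x a' (esym pa')) _; apply: connect_trans (connect1 ab') _.
by apply: IHq; rewrite pb'.
Qed.

(** A fibre is closed under [F]-adjacency, hence each of its vertices keeps two neighbors in it. Two
    distinct fibres then yield disjoint cycles. *)
Lemma fibre_cycle (v : H) : exists2 c : seq G, is_cycle c & forall x, x \in c -> p x = v.
Proof.
have [x0 x0v] := quo_surj quo v.
have [|t|c cc cT] := @min_degree_cycle G [set x | p x == v].
- by apply/set0Pn; exists x0; rewrite inE x0v.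
- rewrite inE => /eqP tv.
  rewrite -[X in X <= _](regF t); apply: subset_leq_card; apply/subsetP => y.
  rewrite !inE => ty; have [-> _] := andP ty; rewrite andbT -tv eq_sym.
  by apply/eqP/(quo_fibre quo)/connect1.
by exists c => // x /cT; rewrite inE => /eqP.
Qed.

Lemma mate_card (x : G) : #|[set y | adj x y && ([set x; y] \notin F)]| = 1.
Proof.
have := cubG x; rewrite -(cardsID [set y | [set x; y] \in F]).
have -> : [set y | adj x y] :&: [set y | [set x; y] \in F] =
    [set y | @adj (spanning F) x y].
  by apply/setP => y; rewrite !inE.
rewrite regF => -[<-]; congr #|pred_of_set _|; by apply/setP => y; rewrite !inE andbC.
Qed.

(** * Degrees and edge cuts carried along the quotient map *)

Lemma image_min_degree (Z : {set G}) :
  (forall z, z \in Z -> 1 < #|[set y in Z | adj z y]|) ->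
  (forall z, z \in Z -> exists2 y, p y = p z & y \notin Z) ->
  forall t, t \in p @: Z -> 1 < #|[set v in p @: Z | adj t v]|.
Proof.
move=> degZ notZ _ /imsetP[z zZ ->]; pose r := spanning_adj F.
pose P := [set x in Z | p x == p z].
(* By the handshake lemma for F on P, the vertices x of P with d x = 1 are even
   in number; at each of them, Z uses the edge outside F. *)
pose d x := #|[set y in P | r x y]|.
have rP x y : x \in P -> y \in Z -> r x y -> y \in P.
  rewrite !inE => /andP[_ /eqP <-] -> xy; rewrite eq_sym.
  by apply/eqP/(quo_fibre quo)/connect1.
have d2 x : d x <= 2.
  rewrite -[X in _ <= X](regF x); apply: subset_leq_card; apply/subsetP => y.
  by rewrite !inE => /andP[].
(* [x] has two neighbors in [Z] but only one edge outside [F], so [d x] is positive, and if [d x] is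
   1 that edge must end in [Z]. *)
have degP x : x \in P -> 0 < d x /\
      (d x < 2 -> exists2 m, m \in Z & adj x m && ([set x; m] \notin F)).
  move=> xP; have xZ : x \in Z by move: xP; rewrite inE => /andP[].
  have sub : [set y in Z | adj x y] \subset
      [set y in P | r x y] :|: [set m in Z | adj x m && ([set x; m] \notin F)].
    apply/subsetP => y; rewrite in_setU !(in_set, in_setI) => /andP[yZ xy]; rewrite yZ xy /=.
    case: (boolP ([set x; y] \in F)) => [xyF|]; last by rewrite orbT.
    have rxy : r x y by rewrite /r /spanning_adj xy.
    by have := rP x y xP yZ rxy; rewrite inE => /andP[_ ->]; rewrite rxy.
  have le := leq_trans (subset_leq_card sub) (leq_card_setU _ _).
  have := leq_trans (degZ x xZ) le; rewrite -/(d x).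
  have le1 : #|[set m in Z | adj x m && ([set x; m] \notin F)]| <= 1.
    rewrite -(mate_card x); apply: subset_leq_card; apply/subsetP => y.
    by rewrite !inE => /andP[].
  move=> two; split.
    by rewrite -(ltn_add2r 1); apply: leq_trans two _; rewrite leq_add2l.
  move=> dx; have /card_gt0P[m] : 0 < #|[set m in Z | adj x m && ([set x; m] \notin F)]|.
    by rewrite -(ltn_add2l (d x)) addn0; exact: leq_trans two.
  by rewrite inE => /andP[mZ xm]; exists m.
(* The fibre of [z] leaves [Z], so an edge of [F] runs from some [a] in [P] out of [Z], costing [a]
   one of its two [F]-neighbors. *)
have [a aP da] : exists2 a, a \in P & d a = 1.
  have [y yz yZ] := notZ z zZ.
  have [a [b [ab aZ bZ za]]] := connect_crossing ((quo_fibre quo z y).1 (esym yz)) zZ yZ.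
  have aP : a \in P by rewrite inE aZ eq_sym; apply/eqP/(quo_fibre quo).
  exists a => //; apply/eqP; rewrite eqn_leq (degP a aP).1 andbT -ltnS -(regF a).
  apply: proper_card; apply/properP; split.
    by apply/subsetP => c; rewrite !inE => /andP[].
  by exists b; rewrite !inE ?(negPf bZ).
(* [d] is 1 or 2 on [P]; were [a] the only vertex with value 1, the degree sum would be odd. *)
have [a' [a'P aa' da']] : exists a', [/\ a' \in P, a' != a & d a' = 1].
  have [/existsP[a' /and3P[a'P aa' /eqP da']]|] :=
    boolP [exists a', [&& a' \in P, a' != a & d a' == 1]]; first by exists a'.
  rewrite negb_exists => /forallP none.
  have := handshake P (@adj_sym (spanning F)) (@adj_irrefl (spanning F)).
  rewrite (bigD1 a) //= -/(d a) da (eq_bigr (fun=> 2)).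
    by rewrite big_const iter_addn_0 oddD oddM.
  move=> x /andP[xP xa]; apply/eqP; rewrite eqn_leq d2 /= ltn_neqAle eq_sym (degP x xP).1 andbT.
  by have := none x; rewrite xP xa.
have [_ []] := degP a aP; first by rewrite da.
move=> m mZ /andP[am amF].
have [_ []] := degP a' a'P; first by rewrite da'.
move=> m' m'Z /andP[am' amF'].
have pa : p a = p z by move: aP; rewrite inE => /andP[_ /eqP].
have pa' : p a' = p z by move: a'P; rewrite inE => /andP[_ /eqP].
apply/card_gt1P; exists (p m), (p m'); rewrite !inE !imset_f //= -{1}pa -pa' !quo_adj //.
(* With equal images the two edges would coincide by [quo_inj]; for [a'] other than [a], this edge
   would join [a] to [a'] and give a loop at [p z]. *)
split=> //; apply: contraTneq aa' => mm'.
have /(quo_inj quo) : p @: [set a; m] = p @: [set a'; m'].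
  by rewrite !imsetU !imset_set1 pa pa' mm'.
rewrite !inE amF amF' !set2_edges am am' => /(_ isT isT) E.
have := set21 a' m'; rewrite -E !inE => /orP[->//|/eqP a'm].
by have := quo_adj am amF; rewrite pa -a'm pa' adj_irrefl.
Qed.

(** For a side [S] of the cut, [inner S] and [inner (~: S)] are the sets U and W, and X is the
    complement of their union. *)
Definition inner (S : {set G}) : {set H} := [set v | [set x | p x == v] \subset S].

Lemma innerP (S : {set G}) (v : H) :
  reflect (forall x, p x = v -> x \in S) (v \in inner S).
Proof.
rewrite inE; apply: (iffP subsetP) => vS x.
  by move=> xv; apply: vS; rewrite inE xv.
by rewrite inE => /eqP; exact: vS.
Qed.

Lemma crossing_fibre (S : {set G}) (v : H) : v \notin inner S :|: inner (~: S) ->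
  exists2 x, x \in S & exists2 y, y \notin S & p x = v /\ p y = v.
Proof.
rewrite !inE negb_or => /andP[/subsetPn[y] + yS] /subsetPn[x].
rewrite !inE negbK => /eqP yv /eqP xv xS.
by exists x => //; exists y.
Qed.

Lemma inner_disjoint (S : {set G}) : [disjoint inner S & inner (~: S)].
Proof.
apply/pred0P => v; apply/negP => /andP[/= /innerP vS /innerP vS'].
by have [x xv] := quo_surj quo v; have := vS' x xv; rewrite inE (vS x xv).
Qed.

Lemma quotient_cut (S : {set G}) :
  #|~: (inner S :|: inner (~: S))| + #|edges_between (inner S) (inner (~: S))|
    <= #|edges_between S (~: S)|.
Proof.
set X := ~: _; set E := edges_between _ _.
(* The elements of X, as singletons, and those of E, as pairs, are all images
   under p of edges of the cut. *)
rewrite -(card_imset _ set1_inj) -cardsUI [_ :&: _](_ : _ = set0); last first.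
  apply/setP => e; rewrite !inE; apply/negP => /andP[/imsetP[v _ ->]].
  case/edges_betweenP=> x [y [xy _ _ vE]].
  have := set21 x y; have := set22 x y; rewrite -vE !inE => /eqP yv /eqP xv.
  by rewrite xv yv adj_irrefl in xy.
rewrite cards0 addn0; apply: leq_trans (leq_imset_card (fun e : {set G} => p @: e) _).
apply: subset_leq_card; apply/subsetP => e; rewrite inE => /orP[].
  case/imsetP=> v; rewrite inE => /crossing_fibre[x xS [y yS [xv yv]]] ->.
  (* The fibre of [v] is connected by [F] and meets both sides, so one of its [F]-edges crosses; its
     image is the singleton of [v]. *)
  have /(quo_fibre quo)/connect_crossing/(_ xS yS)[a [b [ab aS bS xa]]] : p x = p y by rewrite xv.
  apply/imsetP; exists [set a; b].
    by apply/edges_betweenP; exists a, b; rewrite inE; case/andP: ab.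
  have pa : p a = v by rewrite -xv; apply/esym/(quo_fibre quo).
  have pb : p b = v by rewrite -pa; apply/esym/(quo_fibre quo)/connect1.
  by rewrite imsetU !imset_set1 pa pb setUid.
case/edges_betweenP=> u [w [uw /innerP uS /innerP wS] ->].
have [|e' /setDP[/imsetP[[a b]]]] := quo_lift quo (e := [set u; w]);
  first by rewrite set2_edges.
rewrite inE /= => ab -> _ E'; apply/imsetP; exists [set a; b] => //.
have nuw : u != w by apply: contraTneq uw => ->; rewrite adj_irrefl.
move: (E') (set21 u w) (set22 u w) nuw; rewrite imsetU !imset_set1 => ->; rewrite !inE.
case/orP=> /eqP uE /orP[] /eqP wE; rewrite uE wE ?eqxx // => _; apply/edges_betweenP.
  by exists a, b; rewrite uS // wS.
by exists b, a; rewrite adj_sym setUC uS // wS.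
Qed.

(** Otherwise every fibre has a vertex outside [Z], so [p @: Z] contains a cycle; its vertices all
    have crossing fibres, hence are at most as many as the cut edges, against the girth. *)
Lemma inner_nonempty (k : nat) (S Z : {set G}) :
  girth_geq H k -> #|edges_between S (~: S)| < k -> Z \subset S -> Z != set0 ->
  (forall z, z \in Z -> 1 < #|[set y in Z | adj z y]|) -> inner S != set0.
Proof.
move=> Hk Sk ZS Z0 degZ; apply/negP => /eqP S0.
have out v : exists2 y, p y = v & y \notin S.
  have : v \notin inner S by rewrite S0 inE.
  by rewrite inE => /subsetPn[y]; rewrite inE => /eqP; exists y.
have [| |c cc cZ] := @min_degree_cycle H (p @: Z).
- by rewrite imset_eq0.
- apply: image_min_degree => // z _; have [y yz yS] := out (p z); exists y => //.
  by apply: contraNN yS; apply: (subsetP ZS).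
have := girth_leq Hk cc; rewrite leqNgt => /negP[]; apply: leq_ltn_trans Sk.
apply: leq_trans (quotient_cut S); apply: leq_trans (leq_addr _ _).
have /and3P[_ cu _] := cc; rewrite -(card_uniqP cu); apply: subset_leq_card.
apply/subsetP => v /cZ/imsetP[z zZ vz]; rewrite S0 set0U inE.
apply/innerP => /(_ z (esym vz)).
by rewrite inE (subsetP ZS).
Qed.

End Quotient.

(** * Cyclic edge-connectivity of the inflation *)

Lemma k_connected_connected (k : nat) (H : sgraph) : 0 < k ->
  k_connected k H -> connected H.
Proof.
move=> k0 [kH /(_ set0)]; rewrite cards0 => /(_ k0)[_ conH].
split; first exact: leq_ltn_trans kH.
move=> x y; have inT v : v \in (~: set0 : {set H}) by rewrite !inE.
apply: contraT => xy.
(* Deleting the empty set gives a copy of [H] on a subtype; none of its edges leaves the set of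
   vertices reachable from [x] in [H]. *)
have := @connect_crossing _ _ [set v | connect (@adj H) x (val v)] _ _
  (conH (Sub x (inT x)) (Sub y (inT y))).
rewrite !inE /= connect0 xy => /(_ isT isT)[a [b []]]; rewrite !inE => ab xa.
by rewrite (connect_trans xa (connect1 (ab : adj (val a) (val b)))).
Qed.

Theorem theorem7 (k : nat) (H : sgraph) (hk : 3 <= k)
  (Hconn : k_connected k H) (Hgirth : girth_geq H k) (G : sgraph)
  (HG : inflation G H) : cyclically_edge_connected k G.
Proof.
have [F [p [cubG regF quo]]] := inflation_quotient HG.
split=> //.
- apply: (quotient_connected quo); apply: k_connected_connected Hconn; exact: leq_trans hk.
- have /card_gt1P[u [w [_ _ uw]]] : 1 < #|H|.
    by case: Hconn => kH _; apply: ltn_trans kH; apply: ltn_trans hk.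
  have [c1 cc1 c1u] := fibre_cycle regF quo u.
  have [c2 cc2 c2w] := fibre_cycle regF quo w.
  exists c1, c2; split=> //; apply/pred0P => x; apply/negP => /andP[/= /c1u xu /c2w xw].
  by rewrite -xu xw eqxx in uw.
move=> D DG Dk [A [B [/imsetP[a _ AE] /imsetP[b _ BE] AB [cA cAc cAA] [cB cBc cBB]]]].
have dsym : connect_sym (@adj (del_edges D)) by apply: sym_connect_sym; exact: adj_sym.
have BA x : x \in B -> x \in ~: A.
  move=> xB; rewrite inE; apply: contra AB => xA; apply/eqP; rewrite AE BE.
  move: xA xB; rewrite AE BE !inE => ax bx; apply/setP => y; rewrite !inE.
  by rewrite (same_connect dsym ax) (same_connect dsym bx).
have cut : @edges_between G A (~: A) \subset D.
  apply/subsetP => e /edges_betweenP[x [y [xy xA]]]; rewrite inE => yA ->.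
  apply: contraNT yA => xyD; move: xA; rewrite AE !inE => /connect_trans; apply.
  by apply: connect1; rewrite /= /spanning_adj xy inE.
have cutk : #|@edges_between G A (~: A)| < k.
  exact: leq_ltn_trans (subset_leq_card cut) Dk.
(* Edges are unordered, so both sides have the same cut and one argument serves for [A] and for its
   complement. *)
have cut' : @edges_between G (~: A) (~: ~: A) = @edges_between G A (~: A).
  rewrite setCK; apply/setP => e.
  by apply/(@edges_betweenP G)/(@edges_betweenP G) => -[x [y [xy xA yA ->]]];
    exists y, x; rewrite adj_sym setUC.
(* A cycle avoiding [D] is a cycle of [G], and its vertex set serves as [Z]. *)
have ne (S : {set G}) (c : seq G) : @is_cycle (del_edges D) c -> {subset c <= S} ->
    #|edges_between S (~: S)| < k -> inner p S != set0.
  move=> cc cS Sk; have gc : is_cycle (c : seq G).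
    case/and3P: cc => c2 cu cc; apply/and3P; split=> //.
    by apply: sub_cycle cc => x y /andP[].
  apply: (inner_nonempty (Z := [set x in c]) cubG regF quo Hgirth Sk).
  - by apply/subsetP => x; rewrite inE => /cS.
  - by case: c gc {cc cS} => [|x c] // _; apply/set0Pn; exists x; rewrite inE mem_head.
  move=> z; rewrite inE => zc; rewrite (eq_card (B := [set y | (y \in c) && adj z y])).
    exact: cycle_degree.
  by move=> y; rewrite !inE.
have UA := ne A cA cAc cAA cutk.
have WA : inner p (~: A) != set0.
  by apply: (ne _ cB) => //; [move=> x /cBB/BA | rewrite cut'].
have := k_connected_mixed_cut Hconn UA WA (inner_disjoint quo A).
by apply/negP; rewrite -ltnNge; apply: leq_ltn_trans (quotient_cut quo A) cutk.
Qed.
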